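(* For all positive integers $n$ and non-negative integers $k$, with $n_1$ denoting a non-negative integer and $Q_m:=\dfrac{y^{(k+1)m}-x^{(k+1)m}}{y^{k+1}-x^{k+1}}$ (a polynomial in $x,y$), $$\det_{0\le i,j\le n-1}\Big(\sum_{l\ge0}\mathcal P^+_{i+j+1}(k,l)\Big)= \begin{cases} (-1)^{n_1\binom{k+1}2}(xy)^{(k+1)^2\binom{n_1+1}2-n}\big(Q_{n_1+1}+(-1)^kQ_{n_1}\big), & \text{if } n=(k+1)n_1,\\ (-1)^{n_1\binom{k+1}2}(xy)^{(k+1)^2\binom{n_1+1}2}(1+x)(1+y)\,Q_{n_1+1}, & \text{if } n=(k+1)n_1+1,\\ (-1)^{(n_1+1)\binom{k+1}2+k}(xy)^{(k+1)^2\binom{n_1+1}2+(k^2-1)(n_1+1)}(1+x)(1+y)\,Q_{n_1+1}, & \text{if } n=(k+1)n_1+k,\\ 0, & \text{if } n\not\equiv 0,1,k \pmod{k+1}. \end{cases}$$ For $k=0$ only the first case applies, and for $k=1$ only the first two cases apply.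
   Context: Three-step paths consist of up-steps $(1,1)$, level steps $(1,0)$ and down-steps $(1,-1)$. Weights: $w((1,1))=1$, $w((1,0))=x+y$, $w((1,-1))=xy$, and the weight $w(P)$ of a path is the product of the weights of its steps. $\mathcal P_n(k,l)=\sum_P w(P)$ over all three-step paths from $(0,k)$ to $(n,l)$; $\mathcal P^+_n(k,l)$ is the same sum restricted to paths that never run below the $x$-axis. For fixed $n,k$ the sum $\sum_{l\ge0}\mathcal P^+_n(k,l)$ is finite. These are polynomials in the indeterminates $x,y$. *)

(* Defs.v *)
From HB Require Import structures.
From mathcomp Require Import all_boot all_order all_algebra.
Set Implicit Arguments. Unset Strict Implicit. Unset Printing Implicit Defensive.
Import Order.TTheory GRing.Theory Num.Theory.
Local Open Scope ring_scope.

(* Steps of a three-step path, encoded in the finType [option bool]: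
   Some true = up-step (1,1), None = level step (1,0), Some false = down-step (1,-1). *)
Definition step := option bool.

Definition incr (s : step) : int :=
  match s with Some true => 1 | None => 0 | Some false => -1 end.

Definition wstep (R : comRingType) (x y : R) (s : step) : R :=
  match s with Some true => 1 | None => x + y | Some false => x * y end.

Definition heights (k : nat) (p : seq step) : seq int :=
  scanl (fun h s => h + incr s) (k%:Z) p.

Definition endheight (k : nat) (p : seq step) : int := last (k%:Z) (heights k p).

Definition nonneg_path (k : nat) (p : seq step) : bool :=
  all (fun h => 0 <= h) (heights k p).

Definition Pplus (R : comRingType) (x y : R) (n k l : nat) : R :=
  \sum_(p : n.-tuple step | nonneg_path k p && (endheight k p == l%:Z))
     \prod_(s <- p) wstep x y s.

(* sum_{l >= 0} P^+_n(k,l); endpoints satisfy l <= k + n, so the sum is over l < k+n+1 *)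
Definition Pplus_total (R : comRingType) (x y : R) (n k : nat) : R :=
  \sum_(l < k + n + 1) Pplus x y n k l.

(* Q_m = (y^{(k+1)m} - x^{(k+1)m}) / (y^{k+1} - x^{k+1}), written as the quotient polynomial *)
Definition Qpoly (R : comRingType) (x y : R) (k m : nat) : R :=
  \sum_(j < m) y ^+ ((k + 1) * j) * x ^+ ((k + 1) * (m - 1 - j)).

Definition Zxy := {poly {poly int}}.
Definition xv : Zxy := 'X.
Definition yv : Zxy := ('X)%:P.

Definition hankel_det (n k : nat) : Zxy :=
  \det (\matrix_(i < n, j < n) Pplus_total xv yv (i + j + 1) k).

(* Main.v *)
Require Import Defs.
From HB Require Import structures.
From mathcomp Require Import all_boot all_order all_algebra.
From mathcomp Require Import perm zify ring.
Import Order.TTheory GRing.Theory Num.Theory.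
Import Pdiv.CommonRing Pdiv.RingMonic.
Local Open Scope ring_scope.

(** Write [q = x y] and let [cheb m] be the shifted Chebyshev polynomials
    [cheb 0 = 0], [cheb 1 = 1], [cheb m.+2 = (t - x - y) cheb m.+1 - q cheb m].
    If [L] is the linear functional whose moments are the path totals started
    at height 0, then [L (t^m cheb k.+1)] is the path total of length [m]
    started at height [k], so the determinant is the Hankel determinant of [L]
    with respect to the weight [t cheb k.+1].  The polynomials
    [orth l = cheb l.+1 - cheb l] are orthogonal for [L], with norms [q^l];
    as in Christoffel's formula, this turns the [n x n] determinant into a
    [(k+1) x (k+1)] determinant formed from the residues modulo [cheb k.+1] and
    the values at [t = 0] of polynomials spanning [orth n, ..., orth (n + k)].
    The reflection [cheb (a + m) = - q^m cheb (a - m)] modulo [cheb a] makes the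
    residues periodic up to sign and powers of [q] with period [k + 1], and
    yields one element of that span, or two if [n] is not congruent to 0, 1 or
    [k], divisible by [cheb k.+1]: the small determinant is expanded along the
    corresponding row, or vanishes. *)

(** * Totals of nonnegative paths and their first-step recurrence *)

Section PathRecurrence.
Variables (R : comNzRingType) (x y : R).

Let advance (h : int) (s : step) : int := h + incr s.

Lemma last_scanl_ge0 (h : int) (p : seq step) :
  0 <= h -> all (fun h => 0 <= h) (scanl advance h p) ->
  0 <= last h (scanl advance h p).
Proof.
elim: p h => [|s p IHp] h //= h0 /andP[hs hp].
exact: IHp.
Qed.

Lemma last_scanl_le (h : int) (p : seq step) :
  last h (scanl advance h p) <= h + (size p)%:Z.
Proof.
elim: p h => [|s p IHp] h /=; first by lia.
apply: (le_trans (IHp _)); rewrite /advance.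
by case: s => [[]|] /=; lia.
Qed.

(** A nonnegative path of length [n] ends at a height between 0 and [k + n], so the truncated sum
    over endpoints partitions all such paths. *)
Lemma Pplus_totalE n k : Pplus_total x y n k =
  \sum_(p : n.-tuple step | nonneg_path k p) \prod_(s <- p) wstep x y s.
Proof.
rewrite /Pplus_total /Pplus.
pose h (p : n.-tuple step) : 'I_(k + n).+1 := inord `|endheight k p|%N.
rewrite [RHS](partition_big h predT) //= addn1; apply: eq_bigr => l _.
apply: eq_bigl => p; case: (boolP (nonneg_path k p)) => //= nn.
have ge : 0 <= endheight k p by exact: last_scanl_ge0.
have le : endheight k p <= k%:Z + (size p)%:Z by exact: last_scanl_le.
rewrite size_tuple in le.
have [e le_e Ee] : exists2 e, (e <= k + n)%N & endheight k p = e%:Z.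
  by exists `|endheight k p|%N; lia.
have -> : h p = inord e by rewrite /h Ee.
by rewrite Ee -val_eqE /= inordK.
Qed.

Lemma big_tuple_recl (T : finType) n (P : pred (seq T)) (F : seq T -> R) :
  \sum_(p : n.+1.-tuple T | P p) F p =
  \sum_s \sum_(p : n.-tuple T | P (s :: p)) F (s :: p).
Proof.
rewrite pair_big_dep /=.
rewrite (reindex (fun sp : T * n.-tuple T => cons_tuple sp.1 sp.2)) //=.
exists (fun p => (thead p, behead_tuple p)) => [[s p] _|p _] /=.
  by congr pair; apply: val_inj.
by rewrite [RHS]tuple_eta; apply: val_inj.
Qed.

Lemma big_step (F : step -> R) :
  \sum_s F s = F (Some true) + F None + F (Some false).
Proof.
rewrite (bigD1 (Some true)) // (bigD1 None) // (bigD1 (Some false)) //=.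
by rewrite big1 ?addr0 ?addrA // => -[[]|].
Qed.

Lemma Pplus_total0 k : Pplus_total x y 0 k = 1.
Proof.
rewrite Pplus_totalE (eq_bigl predT) => [|p]; last by rewrite tuple0.
rewrite (eq_bigr (fun=> 1)) => [|p _]; last by rewrite tuple0 big_nil.
by rewrite sumr_const card_tuple.
Qed.

(** Splits off the first step, so the starting height moves while the endpoint stays free; from
    height 0 a first down-step is forbidden. *)
Lemma Pplus_totalS n k : Pplus_total x y n.+1 k =
  Pplus_total x y n k.+1 + (x + y) * Pplus_total x y n k
  + (if k is k'.+1 then x * y * Pplus_total x y n k' else 0).
Proof.
rewrite Pplus_totalE (big_tuple_recl _ _ (nonneg_path k)
  (fun p => \prod_(s <- p) wstep x y s)) big_step.
have stepE s k' : (k%:Z + incr s = k'%:Z)%R ->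
    \sum_(p : n.-tuple step | nonneg_path k (s :: p))
       \prod_(s <- s :: p) wstep x y s = wstep x y s * Pplus_total x y n k'.
  move=> E; rewrite Pplus_totalE big_distrr /=; apply: eq_big => p.
    by rewrite /nonneg_path /heights /= E.
  by move=> _; rewrite big_cons.
rewrite (stepE _ k.+1); last by rewrite /=; lia.
rewrite (stepE _ k) /=; last by lia.
rewrite mul1r; congr (_ + _).
case: k stepE => [|k] stepE; first by rewrite big_pred0.
by rewrite (stepE _ k) //=; lia.
Qed.

End PathRecurrence.

(** * Determinants under row permutations, sparse rows and changes of basis *)

Section Determinants.
Variable R : comNzRingType.

Lemma det_row_perm n (s : 'S_n) (A : 'M[R]_n) :
  \det (row_perm s A) = (-1) ^+ s * \det A.
Proof. by rewrite row_permE det_mulmx det_perm. Qed.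

Lemma det_rotate_rows n d (c : nat -> nat -> R) :
  \det (\matrix_(i < n, j < n) c ((i + d) %% n)%N j) =
  (-1) ^+ (d * n.-1) * \det (\matrix_(i < n, j < n) c i j).
Proof.
case: n => [|n]; first by rewrite !det_mx00 muln0 mulr1.
elim: d c => [|d IHd] c.
  rewrite mul0n mul1r; congr (\det _); apply/matrixP => i j.
  by rewrite !mxE addn0 modn_small.
rewrite mulSn exprD -mulrA [(-1) ^+ n * _]mulrCA.
have -> : (-1) ^+ n * \det (\matrix_(i < n.+1, j < n.+1) c i j) =
    \det (\matrix_(i < n.+1, j < n.+1) c (i.+1 %% n.+1)%N j).
  (* The cycle sending the last index to 0 and every other [i] to [i + 1]; the size is [n.+1], so
     its parity is that of [n]. *)
  pose s : 'S_n.+1 := lift_perm ord_max ord0 1.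
  have s_odd : odd_perm s = odd n.
    by rewrite odd_lift_perm odd_perm1 addbF addbF.
  rewrite -signr_odd -s_odd -det_row_perm; congr (\det _).
  apply/matrixP => i j; rewrite !mxE; congr c.
  case: (unliftP ord_max i) => [i' ->|->] /=.
    rewrite lift_perm_lift perm1 /= /bump; case: i' => i' /= lt.
    by rewrite leqNgt lt add0n modn_small.
  by rewrite lift_perm_id /= modnn.
rewrite -(IHd (fun i j => c (i.+1 %% n.+1)%N j)); congr (\det _).
apply/matrixP => i j; rewrite !mxE; congr c.
by rewrite -[in RHS]addn1 modnDml addn1 addnS.
Qed.

(** Reversal of [n.+1] points sends 0 to the last point and reverses the other [n]; this adds [n] to
    the parity, in step with Pascal's rule. *)
Lemma odd_perm_rev_ord n : odd_perm (perm (@rev_ord_inj n)) = odd 'C(n, 2).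
Proof.
elim: n => [|n IHn].
  by rewrite (_ : perm _ = 1%g) ?odd_perm1 //; apply/permP => -[].
rewrite binS bin1 oddD -IHn.
suff -> : perm (@rev_ord_inj n.+1)
    = lift_perm ord0 ord_max (perm (@rev_ord_inj n)).
  by rewrite odd_lift_perm /= addbC.
apply/permP => i; rewrite permE; case: (unliftP ord0 i) => [j ->|->].
  rewrite lift_perm_lift permE; apply: val_inj => /=.
  by rewrite /bump /=; case: j => j /= j_lt; lia.
by rewrite lift_perm_id; apply: val_inj; rewrite /= subSS subn0.
Qed.

Lemma det_reverse_rows n (c : nat -> nat -> R) :
  \det (\matrix_(i < n, j < n) c (n - i.+1)%N j) =
  (-1) ^+ 'C(n, 2) * \det (\matrix_(i < n, j < n) c i j).
Proof.
rewrite -signr_odd -odd_perm_rev_ord -det_row_perm; congr (\det _).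
by apply/matrixP => i j; rewrite !mxE permE.
Qed.

Lemma det_single_row k (A : 'M[R]_k.+1) i :
  (forall j, j != ord_max -> A i j = 0) ->
  \det A = A i ord_max * ((-1) ^+ (i + k) * \det (row' i (col' ord_max A))).
Proof.
move=> A0; rewrite (expand_det_row A i) (bigD1 ord_max) //= big1 ?addr0 //.
by move=> j /A0->; rewrite mul0r.
Qed.

Lemma det_row0 n (A : 'M[R]_n) i : (forall j, A i j = 0) -> \det A = 0.
Proof.
by move=> A0; rewrite (expand_det_row A i) big1 // => j _; rewrite A0 mul0r.
Qed.

(** Expansion along row [i1] removes the last column, after which row [i2] is zero. *)
Lemma det_two_single_rows k (A : 'M[R]_k.+1) i1 i2 : i1 != i2 ->
  (forall j, j != ord_max -> A i1 j = 0) ->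
  (forall j, j != ord_max -> A i2 j = 0) -> \det A = 0.
Proof.
move=> ne12 A1 A2; rewrite (det_single_row _ _ _ A1).
case: (unliftP i1 i2) => [i Ei|E]; last by rewrite E eqxx in ne12.
rewrite (det_row0 _ _ i) ?mulr0 // => j; rewrite !mxE -Ei A2 //.
by rewrite eq_sym neq_lift.
Qed.

Lemma det_monic_coefs n (b : nat -> {poly R}) :
  (forall l, (l < n)%N -> b l \is monic /\ size (b l) = l.+1) ->
  \det (\matrix_(l < n, i < n) (b l)`_i) = 1.
Proof.
move=> b_monic; rewrite det_trig.
  rewrite big1 // => i _; rewrite mxE.
  by have [/monicP bm bs] := b_monic _ (ltn_ord i); rewrite /lead_coef bs in bm.
apply/is_trig_mxP => i j lt_ij; rewrite mxE nth_default //.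
by have [_ ->] := b_monic _ (ltn_ord i).
Qed.

(** The coefficient matrix of [b] in the monomials is unitriangular, so any basis of monic
    polynomials of degrees 0 to [n - 1] gives the same determinant. *)
Lemma det_monic_basis n (F : nat -> {poly R} -> R) (b : nat -> {poly R}) :
  (forall j, (j < n)%N -> linear_for *%R (F j)) ->
  (forall l, (l < n)%N -> b l \is monic /\ size (b l) = l.+1) ->
  \det (\matrix_(l < n, j < n) F j (b l)) =
  \det (\matrix_(l < n, j < n) F j 'X^l).
Proof.
move=> F_lin b_monic; rewrite -[RHS]mul1r -(det_monic_coefs _ _ b_monic).
rewrite -det_mulmx; congr (\det _); apply/matrixP => l j; rewrite !mxE.
have lin := F_lin j (ltn_ord j).
have F0 : F j 0 = 0.
  by have := lin (-1) 0 0; rewrite scaler0 addr0 mulN1r addNr.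
have [_ bs] := b_monic _ (ltn_ord l).
under eq_bigr do rewrite !mxE.
have {1}-> : b l = \sum_(i < n) (b l)`_i *: 'X^i.
  rewrite -[LHS]coefK poly_def (big_ord_widen n (fun i => (b l)`_i *: 'X^i)).
    rewrite [RHS](bigID (fun i : 'I_n => (i < size (b l))%N)) /=.
    rewrite [X in _ + X]big1 ?addr0 // => i; rewrite -leqNgt => le.
    by rewrite nth_default ?scale0r.
  by rewrite bs.
by elim/big_rec2: _ => [|i u v _ <-] //; exact: lin.
Qed.

End Determinants.

(** * Chebyshev polynomials: reflection, divisibility and values at 0 *)

Section Chebyshev.
Variables (R : comNzRingType) (x y : R).

Local Notation mu := (Pplus_total x y).

Fixpoint cheb (m : nat) : {poly R} :=
  if m is m1.+1 then
    if m1 is m2.+1 then ('X - (x + y)%:P) * cheb m1 - (x * y) *: cheb m2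
    else 1
  else 0.

Lemma chebSS m :
  cheb m.+2 = ('X - (x + y)%:P) * cheb m.+1 - (x * y) *: cheb m.
Proof. by []. Qed.

Lemma cheb_monic_size m : cheb m.+1 \is monic /\ size (cheb m.+1) = m.+1.
Proof.
elim/ltn_ind: m => -[|m] IHm; first by rewrite /= monic1 size_poly1.
have [mon_m sz_m] := IHm m (ltnSn m).
have sz1 : size (('X - (x + y)%:P) * cheb m.+1) = m.+2.
  by rewrite size_monicM ?monicXsubC ?monic_neq0 // size_XsubC sz_m.
have sz2 : (size (- ((x * y) *: cheb m)) < m.+2)%N.
  rewrite size_polyN; apply: leq_ltn_trans (size_scale_leq _ _) _.
  case: m IHm {mon_m sz_m sz1} => [|m] IHm; first by rewrite /= size_poly0.
  by have [_ ->] := IHm m (leqnSn _); lia.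
rewrite chebSS; split; last by rewrite size_polyDl sz1.
by rewrite monicE lead_coefDl ?sz1 // -monicE monicMl ?monicXsubC.
Qed.

Lemma cheb_monic m : cheb m.+1 \is monic.
Proof. by case: (cheb_monic_size m). Qed.

Lemma size_cheb m : size (cheb m) = m.
Proof. by case: m => [|m]; [rewrite size_poly0 | case: (cheb_monic_size m)]. Qed.

(** As a function of [m], the sum satisfies the recurrence of [cheb], with initial values [2 cheb a]
    and [(t - x - y) cheb a]; hence it stays a multiple of [cheb a]. *)
Lemma cheb_reflect a m : (m <= a)%N ->
  exists g, cheb (a + m) + (x * y) ^+ m *: cheb (a - m) = g * cheb a.
Proof.
elim/ltn_ind: m => -[|[|m]] IHm le_ma.
- by exists 2; rewrite addn0 subn0 scale1r; ring.
- case: a le_ma {IHm} => // a _; exists ('X - (x + y)%:P).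
  by rewrite addn1 subn1 expr1 chebSS subrK.
have [g1 E1] := IHm m.+1 (ltnSn _) (ltnW le_ma).
have [g0 E0] := IHm m (leqnSn _) (ltnW (ltnW le_ma)).
exists (('X - (x + y)%:P) * g1 - (x * y)%:P * g0).
rewrite mulrBl -!mulrA -E1 -E0 !addnS chebSS.
have -> : (a - m = (a - m.+2).+2)%N by lia.
have -> : (a - m.+1 = (a - m.+2).+1)%N by lia.
by rewrite chebSS -!mul_polyC !rmorphXn /= !exprS; ring.
Qed.

(** Reflection about [d * n.+1] by [d] writes [cheb (d * n.+2)] as a multiple of [cheb (d * n.+1)]
    minus [(x y)^d cheb (d * n)]. *)
Lemma cheb_dvd d n : exists g, cheb (d * n) = g * cheb d.
Proof.
elim/ltn_ind: n => -[|[|n]] IHn.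
- by exists 0; rewrite muln0 mul0r.
- by exists 1; rewrite muln1 mul1r.
have [g1 E1] := IHn n.+1 (ltnSn _).
have [g0 E0] := IHn n (leqnSn _).
have le : (d <= d * n.+1)%N by rewrite leq_pmulr.
have [g E] := @cheb_reflect (d * n.+1) d le.
exists (g * g1 - (x * y) ^+ d *: g0).
have -> : (d * n.+2 = d * n.+1 + d)%N by lia.
have dE : (d * n.+1 - d = d * n)%N by lia.
by rewrite mulrBl -mulrA -E1 -E dE -scalerAl -E0 addrK.
Qed.

(** At [t = 0] the recurrence has characteristic roots [-x] and [-y]; this is its Binet formula with
    the denominator cleared. *)
Lemma horner0_cheb m :
  (y - x) * (cheb m).[0] = (-1) ^+ m.+1 * (y ^+ m - x ^+ m).
Proof.
elim/ltn_ind: m => -[|[|m]] IHm.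
- by rewrite /= horner0 !expr0; ring.
- by rewrite /= hornerC; ring.
have E1 := IHm m.+1 (ltnSn _); have E0 := IHm m (leqnSn _).
transitivity (- (x + y) * ((y - x) * (cheb m.+1).[0])
              - x * y * ((y - x) * (cheb m).[0])).
  by rewrite chebSS hornerD hornerN hornerM hornerZ hornerXsubC; ring.
by rewrite E1 E0 !exprS; ring.
Qed.

(** * The moment functional and its orthogonal polynomials *)

Definition moment_fun (f : {poly R}) : R := \sum_(i < size f) f`_i * mu i 0.

Lemma moment_fun_widen m (f : {poly R}) : (size f <= m)%N ->
  moment_fun f = \sum_(i < m) f`_i * mu i 0.
Proof.
move=> le_m; rewrite /moment_fun (big_ord_widen m (fun i => f`_i * mu i 0)) //.
rewrite [RHS](bigID (fun i : 'I_m => (i < size f)%N)) /=.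
rewrite [X in _ = _ + X]big1 ?addr0 // => i; rewrite -leqNgt => le.
by rewrite nth_default ?mul0r.
Qed.

Lemma moment_fun_linear : linear_for *%R moment_fun.
Proof.
move=> a f g; pose m := maxn (size f) (size g).
rewrite !(@moment_fun_widen m) ?leq_maxl ?leq_maxr //.
  rewrite big_distrr -big_split; apply: eq_bigr => i _ /=.
  by rewrite coefD coefZ mulrDl mulrA.
rewrite (leq_trans (size_polyD _ _)) // geq_max leq_maxr andbT.
by rewrite (leq_trans (size_scale_leq _ _)) ?leq_maxl.
Qed.

Lemma moment_funZ a f : moment_fun (a *: f) = a * moment_fun f.
Proof.
have f0 : moment_fun 0 = 0 by rewrite /moment_fun size_poly0 big_ord0.
by rewrite -[a *: f]addr0 moment_fun_linear f0 addr0.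
Qed.

Lemma moment_funD f g : moment_fun (f + g) = moment_fun f + moment_fun g.
Proof. by rewrite -[f]scale1r moment_fun_linear mul1r scale1r. Qed.

Lemma moment_funB f g : moment_fun (f - g) = moment_fun f - moment_fun g.
Proof. by rewrite -scaleN1r moment_funD moment_funZ mulN1r. Qed.

Lemma moment_fun_Xn m : moment_fun 'X^m = mu m 0.
Proof.
rewrite (@moment_fun_widen m.+1) ?size_polyXn // big_ord_recr /= coefXn eqxx.
rewrite mul1r big1 ?add0r // => i _.
by rewrite coefXn (ltn_eqF (ltn_ord i)) mul0r.
Qed.

(** The first-step recurrence, solved for the total started one level higher, is the recurrence of
    [cheb]. *)
Lemma moment_fun_cheb m k : moment_fun ('X^m * cheb k.+1) = mu m k.
Proof.
elim/ltn_ind: k m => -[|k] IHk m; first by rewrite mulr1 moment_fun_Xn.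
rewrite chebSS mulrBr mulrA mulrBr -exprSr mulrBl -scalerAr.
rewrite -['X^m * _%:P]mulrC mul_polyC -scalerAl !moment_funB !moment_funZ.
rewrite !IHk // Pplus_totalS.
case: k IHk => [|k] IHk.
  by rewrite mulr0 /moment_fun size_poly0 big_ord0; ring.
by rewrite IHk; [ring | lia].
Qed.

Definition orth l := cheb l.+1 - cheb l.

Lemma orth_monic_size l : orth l \is monic /\ size (orth l) = l.+1.
Proof.
have lt : (size (- cheb l) < size (cheb l.+1))%N.
  by rewrite size_polyN !size_cheb.
rewrite /orth size_polyDl // size_cheb; split => //.
by rewrite monicE lead_coefDl // -monicE cheb_monic.
Qed.

(** The moment is a difference of path totals from adjacent heights, so it inherits the first-step
    recurrence. Induction on [i <= l] leaves only the down-step term, which contributes a factor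
    [x y]. *)
Lemma moment_fun_orth i l : (i <= l)%N ->
  moment_fun ('X^i * orth l) = (x * y) ^+ l *+ (i == l).
Proof.
have nuE j m : moment_fun ('X^j * orth m)
    = mu j m - (if m is m'.+1 then mu j m' else 0).
  rewrite mulrBr moment_funB moment_fun_cheb; congr (_ - _).
  case: m => [|m]; last exact: moment_fun_cheb.
  by rewrite mulr0 /moment_fun size_poly0 big_ord0.
elim: i l => [|i IHi] [|l] // le_il.
- by rewrite nuE Pplus_total0 subr0.
- by rewrite nuE !Pplus_total0 subrr.
have -> : moment_fun ('X^(i.+1) * orth l.+1)
    = moment_fun ('X^i * orth l.+2) + (x + y) * moment_fun ('X^i * orth l.+1)
      + x * y * moment_fun ('X^i * orth l).
  by rewrite !nuE !Pplus_totalS; case: l {le_il} => [|l]; ring.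
rewrite !IHi ?eqSS; try lia.
have -> : (i == l.+2) = false by lia.
have -> : (i == l.+1) = false by lia.
by rewrite mulr0 !add0r mulrnAr exprS.
Qed.

End Chebyshev.

Arguments cheb : simpl never.

(** * Residues modulo [cheb k.+1] and the reduction to a small determinant *)

Section Christoffel.
Variables (R : comNzRingType) (x y : R).

Local Notation mu := (Pplus_total x y).
Local Notation cheb := (cheb R x y).
Local Notation orth := (orth R x y).
Local Notation moment_fun := (moment_fun R x y).

Definition cheb_mod k (f : {poly R}) : {poly R} := rmodp f (cheb k.+1).

Lemma cheb_modD k f g : cheb_mod k (f + g) = cheb_mod k f + cheb_mod k g.
Proof. exact/rmodpD/cheb_monic. Qed.

Lemma cheb_modZ k a f : cheb_mod k (a *: f) = a *: cheb_mod k f.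
Proof. exact/rmodpZ/cheb_monic. Qed.

Lemma cheb_modB k f g : cheb_mod k (f - g) = cheb_mod k f - cheb_mod k g.
Proof. exact/rmodpB/cheb_monic. Qed.

Lemma cheb_mod_mull k g : cheb_mod k (g * cheb k.+1) = 0.
Proof. exact/rmodp_mull/cheb_monic. Qed.

Lemma cheb_mod_mult k n : cheb_mod k (cheb (k.+1 * n)) = 0.
Proof. by have [g ->] := cheb_dvd R x y k.+1 n; rewrite cheb_mod_mull. Qed.

Lemma cheb_mod_reflect k n m : (m <= k.+1 * n)%N ->
  cheb_mod k (cheb (k.+1 * n + m))
  = - ((x * y) ^+ m *: cheb_mod k (cheb (k.+1 * n - m))).
Proof.
move=> le; have [g E] := cheb_reflect R x y _ _ le.
have [h Eh] := cheb_dvd R x y k.+1 n.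
apply/eqP; rewrite -addr_eq0 -cheb_modZ -cheb_modD E Eh mulrA.
by rewrite cheb_mod_mull.
Qed.

Lemma cheb_mod_small k m : (m <= k)%N -> cheb_mod k (cheb m) = cheb m.
Proof. by move=> le; rewrite /cheb_mod rmodp_small // !size_cheb ltnS. Qed.

Lemma prod_opp_expr k (z : R) :
  \prod_(i < k) - z ^+ i.+1 = (-1) ^+ k * z ^+ 'C(k.+1, 2).
Proof.
elim: k => [|k IHk]; first by rewrite big_ord0 mulr1.
by rewrite big_ord_recr /= IHk [in RHS]binS bin1 exprD !exprS; ring.
Qed.

(** From [n] to [n.+1], reflection about [k.+1 * n.+1] reverses the rows and multiplies row [i] by
    [- (x y)^(i + 1)]. The signs combine because ['C(k, 2) + k = 'C(k.+1, 2)]. *)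
Lemma det_cheb_mod k n : \det (\matrix_(i < k, j < k)
    (cheb_mod k (cheb (k.+1 * n + i.+1)))`_j) = (- (x * y)) ^+ (n * 'C(k.+1, 2)).
Proof.
elim: n => [|n IHn].
  rewrite mul0n expr0 -[RHS](@det_monic_coefs R k (fun l => cheb l.+1)).
    congr (\det _); apply/matrixP => i j; rewrite !mxE muln0 add0n.
    by rewrite cheb_mod_small.
  by move=> l _; rewrite cheb_monic size_cheb.
pose c i j := (cheb_mod k (cheb (k.+1 * n + i.+1)))`_j.
rewrite -/(c _ _) in IHn.
transitivity (\det (diag_mx (\row_(i < k) - (x * y) ^+ i.+1)
                    *m \matrix_(i < k, j < k) c (k - i.+1)%N j)).
  congr (\det _); rewrite mul_diag_mx; apply/matrixP => i j; rewrite !mxE.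
  have lt_ik := ltn_ord i.
  rewrite cheb_mod_reflect; last by rewrite mulnS; lia.
  rewrite coefN coefZ mulNr /c; congr (- (_ * (cheb_mod k (cheb _))`_j)).
  by rewrite mulnS; lia.
rewrite det_mulmx det_diag (eq_bigr (fun i : 'I_k => - (x * y) ^+ i.+1)).
  rewrite det_reverse_rows IHn prod_opp_expr mulSn exprD.
  rewrite [in X in _ = X * _]exprNn [in RHS]binS bin1 exprD binS bin1 !exprD.
  by ring.
by move=> i _; rewrite mxE.
Qed.

(** Functionals vanishing on multiples of ['X * cheb k.+1]; in the matrices only the column [j = k]
    takes the second branch. *)
Definition cheb_coord k (j : nat) (f : {poly R}) : R :=
  if (j < k)%N then (cheb_mod k f)`_j else f.[0].

Lemma cheb_coord_linear k j : linear_for *%R (cheb_coord k j).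
Proof.
move=> a f g; rewrite /cheb_coord; case: ifP => _.
  by rewrite cheb_modD cheb_modZ coefD coefZ.
by rewrite hornerD hornerZ.
Qed.

Lemma det_cheb_coord k : \det (\matrix_(i < k.+1, j < k.+1)
    cheb_coord k j (cheb i.+1)) = (cheb k.+1).[0].
Proof.
rewrite (det_single_row _ _ _ ord_max) => [|j ne_j]; last first.
  rewrite mxE /cheb_coord ifT.
    by rewrite -[X in cheb X]muln1 cheb_mod_mult coef0.
  by have := ltn_ord j; move: ne_j; rewrite -val_eqE /=; lia.
rewrite mxE /cheb_coord /= ltnn -signr_odd oddD addbb expr0 mul1r.
rewrite -[RHS]mulr1; congr (_ * _).
rewrite -[RHS](expr0 (- (x * y))) -(mul0n 'C(k.+1, 2)) -det_cheb_mod.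
congr (\det _); apply/matrixP => i j; rewrite !mxE muln0 add0n.
by rewrite !lift_max ltn_ord.
Qed.

Lemma prod_expr n (z : R) : \prod_(i < n) z ^+ i = z ^+ 'C(n, 2).
Proof.
elim: n => [|n IHn]; first by rewrite big_ord0.
by rewrite big_ord_recr /= IHn binS bin1 exprD.
Qed.

(* Both sides evaluate the functionals [cheb_coord k j] and
   [f |-> moment_fun ('X^i * f)] on a basis of the polynomials of degree at
   most [n + k]: on the left [cheb 1, ..., cheb k.+1, 'X * cheb k.+1, ...],
   on the right [orth 0, ..., orth n.-1, b 0, ..., b k]. *)
Lemma hankel_christoffel n k (b : nat -> {poly R}) :
  (forall i, (i <= k)%N -> b i \is monic /\ size (b i) = (n + i).+1) ->
  (forall i j, (i <= k)%N -> (j < n)%N -> moment_fun ('X^j * b i) = 0) ->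
  (cheb k.+1).[0] * \det (\matrix_(i < n, j < n) mu (i + j + 1) k) =
  (-1) ^+ (n * k.+1) * (x * y) ^+ 'C(n, 2)
  * \det (\matrix_(i < k.+1, j < k.+1) cheb_coord k j (b i)).
Proof.
move=> b_monic b_orth.
pose F j f := if (j < k.+1)%N then cheb_coord k j f
              else moment_fun ('X^(j - k.+1) * f).
have F_lin j : linear_for *%R (F j).
  move=> a f g; rewrite /F; case: ifP => _; first exact: cheb_coord_linear.
  by rewrite mulrDr -scalerAr moment_fun_linear.
pose b1 l := if (l < n)%N then orth l else b (l - n)%N.
pose b2 l := if (l < k.+1)%N then cheb l.+1
             else 'X^(l - k.+1) * ('X * cheb k.+1).
have b1_monic l : (l < k.+1 + n)%N -> b1 l \is monic /\ size (b1 l) = l.+1.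
  move=> lt_l; rewrite /b1; case: ltnP => [_|le_nl].
    exact: orth_monic_size.
  by have [|-> ->] := b_monic (l - n)%N; rewrite ?subnKC //; lia.
have b2_monic l : (l < k.+1 + n)%N -> b2 l \is monic /\ size (b2 l) = l.+1.
  move=> lt_l; rewrite /b2; case: ltnP => [_|le_kl].
    by rewrite cheb_monic size_cheb.
  split; first by rewrite !monicMl ?monicXn ?monicX ?cheb_monic.
  rewrite mulrA -exprSr size_monicM ?monicXn ?monic_neq0 ?cheb_monic //.
  by rewrite size_polyXn size_cheb; lia.
have detE := etrans (det_monic_basis R _ F b2 (fun j _ => F_lin j) b2_monic)
  (esym (det_monic_basis R _ F b1 (fun j _ => F_lin j) b1_monic)).
(* Rotation by [n] moves the rows of [b] above those of [orth]; orthogonality of [b] then makes the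
   matrix block lower triangular. *)
have := det_rotate_rows R (k.+1 + n) n (fun l j => F j (b1 l)).
rewrite -{}detE.
set M1 := (X in \det X = _ -> _); set M2 := (X in _ = _ * \det X -> _).
have -> : \det M1 = \det (\matrix_(i < k.+1, j < k.+1) cheb_coord k j (b i))
    * (x * y) ^+ 'C(n, 2).
  have -> : M1 = block_mx (\matrix_(i < k.+1, j < k.+1) cheb_coord k j (b i)) 0
      (dlsubmx M1) (\matrix_(l < n, i < n) moment_fun ('X^i * orth l)).
    rewrite -[LHS]submxK; congr block_mx; apply/matrixP => i j; rewrite !mxE /=.
    - rewrite /F ltn_ord modn_small; last by rewrite ltn_add2r.
      by rewrite /b1 ltnNge leq_addl /= addnK.
    - rewrite /F ltnNge leq_addr /= modn_small; last by rewrite ltn_add2r.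
      rewrite /b1 ltnNge leq_addl /= addnK addKn b_orth //.
      by rewrite -ltnS.
    rewrite /F ltnNge leq_addr /= addKn addnAC modnDl.
    rewrite modn_small; last by have := ltn_ord i; lia.
    by rewrite /b1 ltn_ord.
  rewrite det_lblock; congr (_ * _).
  (* The moment of ['X^i * orth l] vanishes for [i < l], so the block is upper triangular and is
     transposed first; its diagonal entries are [(x y)^i]. *)
  rewrite -det_tr det_trig.
    rewrite -prod_expr; apply: eq_bigr => i _.
    by rewrite !mxE moment_fun_orth // eqxx.
  apply/is_trig_mxP => i j lt_ij; rewrite !mxE moment_fun_orth ?(ltnW lt_ij) //.
  by rewrite (ltn_eqF lt_ij).
have -> : \det M2 = (cheb k.+1).[0]
    * \det (\matrix_(i < n, j < n) mu (i + j + 1) k).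
  (* The lower rows are multiples of ['X * cheb k.+1], killed by [cheb_coord]; their moments against
     monomials are the entries of the large determinant. *)
  have -> : M2 = block_mx (\matrix_(i < k.+1, j < k.+1) cheb_coord k j (cheb i.+1))
      (ursubmx M2) 0 (\matrix_(i < n, j < n) mu (i + j + 1) k).
    rewrite -[LHS]submxK; congr block_mx; apply/matrixP => i j; rewrite !mxE /=.
    - by rewrite /F /b2 !ltn_ord.
    - rewrite /F ltn_ord /b2 ltnNge leq_addr /= /cheb_coord mulrA.
      rewrite cheb_mod_mull coef0 hornerM hornerMX mulr0 mul0r.
      by case: ifP.
    rewrite /F /b2 ltnNge leq_addr /= ltnNge leq_addr /= !addKn.
    by rewrite mulrA -exprD mulrA -exprSr moment_fun_cheb addn1 addnC.
  by rewrite det_ublock det_cheb_coord.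
(* Parity of [n (k + n)] and [n (k + 1)] agrees because [n^2] and [n] have the same parity. *)
have signE : (-1) ^+ (n * (k.+1 + n).-1) = (-1) ^+ (n * k.+1) :> R.
  rewrite -signr_odd -[RHS]signr_odd !oddM addSn /= oddD.
  by case: (odd n); case: (odd k).
rewrite signE => E; rewrite -[RHS]mulrA [X in _ = _ * X]mulrC E.
by rewrite mulrA -exprD addnn -signr_odd odd_double mul1r.
Qed.

End Christoffel.

(** * Evaluation of the small determinant by the residue class of [n] *)

Section HankelEvaluation.
Variables (R : comNzRingType) (x y : R).

Local Notation mu := (Pplus_total x y).
Local Notation cheb := (cheb R x y).
Local Notation orth := (orth R x y).
Local Notation moment_fun := (moment_fun R x y).
Local Notation cheb_mod := (cheb_mod R x y).
Local Notation cheb_coord := (cheb_coord R x y).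

Lemma monic_size_addr l (f g : {poly R}) :
  f \is monic /\ size f = l.+1 -> (size g <= l)%N ->
  f + g \is monic /\ size (f + g) = l.+1.
Proof.
move=> [f_monic f_size] g_size; have lt : (size g < size f)%N by rewrite f_size.
by rewrite size_polyDl // monicE lead_coefDl // -monicE.
Qed.

Lemma monic_size_cheb_diff l m : (m <= l)%N ->
  cheb l.+1 - cheb m \is monic /\ size (cheb l.+1 - cheb m) = l.+1.
Proof.
move=> le_ml; apply: monic_size_addr; first by rewrite cheb_monic size_cheb.
by rewrite size_polyN size_cheb.
Qed.

(** Up to sign the difference telescopes into terms [orth l] with [l > j], each orthogonal to
    ['X^j]. *)
Lemma moment_fun_cheb_diff j a b : (j < a)%N -> (j < b)%N ->
  moment_fun ('X^j * (cheb a - cheb b)) = 0.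
Proof.
move=> lt_ja lt_jb.
suff diff0 m : moment_fun ('X^j * (cheb (j.+1 + m) - cheb j.+1)) = 0.
  have -> : cheb a - cheb b = (cheb (j.+1 + (a - j.+1)) - cheb j.+1)
      - (cheb (j.+1 + (b - j.+1)) - cheb j.+1).
    by rewrite !subnKC //; ring.
  by rewrite mulrBr moment_funB !diff0 subrr.
elim: m => [|m IHm]; first by rewrite addn0 subrr -(subrr 1) mulrBr moment_funB subrr.
have -> : cheb (j.+1 + m.+1) - cheb j.+1
    = orth (j.+1 + m) + (cheb (j.+1 + m) - cheb j.+1).
  by rewrite /orth addnS; ring.
rewrite mulrDr moment_funD IHm moment_fun_orth; last by lia.
by rewrite addr0 (_ : (j == _) = false) //; lia.
Qed.

(* Divisible by [cheb d] when [d] divides [a], and orthogonal to all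
   polynomials of degree less than [a - m]. *)
Definition mirror a m : {poly R} :=
  (cheb (a + m) - cheb a) - (x * y) ^+ m *: (cheb a - cheb (a - m)).

Lemma monic_size_mirror a m :
  mirror a m.+1 \is monic /\ size (mirror a m.+1) = (a + m).+1.
Proof.
rewrite /mirror addnS; apply: monic_size_addr.
  by apply: monic_size_cheb_diff; exact: leq_addr.
rewrite size_polyN (leq_trans (size_scale_leq _ _)) //.
by rewrite (leq_trans (size_polyD _ _)) // size_polyN !size_cheb; lia.
Qed.

Lemma moment_fun_mirror j a m : (j < a - m)%N ->
  moment_fun ('X^j * mirror a m) = 0.
Proof.
move=> lt; rewrite mulrBr moment_funB -scalerAr moment_funZ.
by rewrite !moment_fun_cheb_diff ?mulr0 ?subrr //; lia.
Qed.

Lemma cheb_mod_mirror k n m : (m <= k.+1 * n)%N ->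
  cheb_mod k (mirror (k.+1 * n) m) = 0.
Proof.
move=> le; rewrite /mirror cheb_modB cheb_modZ !cheb_modB.
by rewrite cheb_mod_reflect // cheb_mod_mult subr0 sub0r scalerN subrr.
Qed.

(** The two terms [x y cheb a] cancel, which leaves the factor [1 + x + y + x y]. *)
Lemma horner0_mirror1 a : (mirror a.+1 1).[0] = - ((1 + x) * (1 + y) * (cheb a.+1).[0]).
Proof.
rewrite /mirror addn1 subn1 expr1 chebSS.
rewrite !(hornerD, hornerN, hornerZ) hornerM hornerXsubC; ring.
Qed.

Lemma det_cheb_coord_expand k (b : nat -> {poly R}) (i : 'I_k.+1) :
  cheb_mod k (b i) = 0 ->
  \det (\matrix_(i < k.+1, j < k.+1) cheb_coord k j (b i)) =
  (b i).[0] * ((-1) ^+ (i + k)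
    * \det (\matrix_(l < k, j < k) (cheb_mod k (b (bump i l)))`_j)).
Proof.
move=> bi0; rewrite (det_single_row _ _ _ i) => [|j ne_j]; last first.
  rewrite mxE /cheb_coord bi0 coef0 ifT //.
  by have := ltn_ord j; move: ne_j; rewrite -val_eqE /=; lia.
rewrite mxE /cheb_coord ltnn; congr (_ * (_ * \det _)).
by apply/matrixP => l j; rewrite !mxE lift_max ltn_ord.
Qed.

(** Here [b i] is the sum of [orth n, ..., orth (n + i)]. Subtracting [cheb n], a multiple of
    [cheb k.+1], keeps the residues, and [b k] is a difference of two multiples. *)
Lemma hankel_residue0 k n1 (n := (k.+1 * n1)%N) :
  (cheb k.+1).[0] * \det (\matrix_(i < n, j < n) mu (i + j + 1) k) =
  (-1) ^+ (n * k.+1) * (x * y) ^+ 'C(n, 2)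
  * (((cheb (k.+1 * n1.+1)).[0] - (cheb n).[0])
     * (- (x * y)) ^+ (n1 * 'C(k.+1, 2))).
Proof.
pose b i := cheb (n + i).+1 - cheb n.
rewrite (hankel_christoffel R x y n k b).
- congr (_ * _); rewrite (det_cheb_coord_expand k b ord_max) /= /b; last first.
    by rewrite -addnS -mulnSr cheb_modB !cheb_mod_mult subr0.
  rewrite -addnS -mulnSr hornerD hornerN -signr_odd oddD addbb mul1r.
  congr (_ * _); rewrite -(det_cheb_mod R x y); congr (\det _).
  apply/matrixP => i j; rewrite !mxE /bump leqNgt ltn_ord add0n.
  by rewrite cheb_modB cheb_mod_mult subr0 -addnS.
- by move=> i _; apply: monic_size_cheb_diff; exact: leq_addr.
by move=> i j _ lt_jn; rewrite moment_fun_cheb_diff // ltnS; lia.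
Qed.

(** The rows come from those of [cheb] by an upper bidiagonal matrix with diagonal [-1]; its last
    row has no second entry since [cheb (k.+1 * n.+1)] has residue 0. *)
Lemma det_cheb_mod_orth k n : \det (\matrix_(i < k, j < k)
    (cheb_mod k (orth (k.+1 * n + i.+1)))`_j)
  = (-1) ^+ k * (- (x * y)) ^+ (n * 'C(k.+1, 2)).
Proof.
rewrite -(det_cheb_mod R x y).
have <- : \det (\matrix_(i < k, l < k) ((l == i.+1 :> nat)%:R - (l == i)%:R))
    = (-1) ^+ k :> R.
  rewrite -det_tr det_trig; last first.
    apply/is_trig_mxP => i j lt_ij; rewrite !mxE.
    by rewrite -val_eqE /= !ltn_eqF ?subr0 //; lia.
  rewrite -[RHS]mulr1 -[in RHS](card_ord k) -prodr_const mulr1.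
  by apply: eq_bigr => i _; rewrite !mxE eqxx ltn_eqF ?ltnSn // sub0r.
rewrite -det_mulmx; congr (\det _); apply/matrixP => i j; rewrite !mxE.
under eq_bigr do rewrite !mxE mulrBl.
rewrite sumrB /orth cheb_modB coefB; congr (_ - _); last first.
  rewrite (bigD1 i) //= eqxx mul1r big1 ?addr0 // => l ne.
  by rewrite (negPf ne) mul0r.
have [lt_ik|ge_ik] := ltnP i.+1 k.
  rewrite (bigD1 (Ordinal lt_ik)) //= eqxx mul1r big1 ?addr0 ?addnS // => l.
  by rewrite -val_eqE /= => /negPf->; rewrite mul0r.
have -> : ((k.+1 * n + i.+1).+1 = k.+1 * n.+1)%N by have := ltn_ord i; nia.
rewrite cheb_mod_mult coef0 big1 // => l _.
by rewrite ltn_eqF ?mul0r // (leq_trans (ltn_ord l)).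
Qed.

(** The multiple of [k.+1] is [a = n + k], and [mirror a 1 = orth a - x y orth (a - 1)] may replace
    the last row [orth (n + k)] because [k > 0]. *)
Lemma hankel_residue1 k n1 (n := (k.+1 * n1).+1) : (0 < k)%N ->
  (cheb k.+1).[0] * \det (\matrix_(i < n, j < n) mu (i + j + 1) k) =
  (-1) ^+ (n * k.+1) * (x * y) ^+ 'C(n, 2)
  * (- ((1 + x) * (1 + y) * (cheb (k.+1 * n1.+1)).[0])
     * ((-1) ^+ k * (- (x * y)) ^+ (n1 * 'C(k.+1, 2)))).
Proof.
move=> k_gt0; pose a := (k.+1 * n1.+1)%N.
have aE : a = (k.+1 * n1 + k).+1 by rewrite /a; lia.
pose b i := if (i < k)%N then orth (n + i) else mirror a 1.
rewrite (hankel_christoffel R x y n k b).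
- congr (_ * _).
  rewrite (det_cheb_coord_expand k b ord_max) /= /b ltnn; last first.
    by rewrite cheb_mod_mirror // aE.
  rewrite [in LHS]aE horner0_mirror1 -aE.
  rewrite -signr_odd oddD addbb mul1r -det_cheb_mod_orth.
  congr (_ * \det _); apply/matrixP => i j.
  have bumpE : bump k i = i by rewrite /bump leqNgt ltn_ord.
  by rewrite !mxE bumpE ltn_ord /n addSnnS.
- move=> i le_ik; rewrite /b; case: ltnP => [_|le_ki]; first exact: orth_monic_size.
  have [-> ->] := monic_size_mirror a 0; split => //.
  by rewrite aE /n; lia.
move=> i j le_ik lt_jn; rewrite /b; case: ltnP => [lt_ik|le_ki].
  by rewrite moment_fun_cheb_diff //; lia.
by rewrite moment_fun_mirror // aE; move: lt_jn; rewrite /n; lia.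
Qed.

(** Now [a = n + 1], and the expansion is along row 1. Row 0 has the residue of [- cheb (a - 1)];
    the extra factor [x y] reflects it to that of [cheb (a + 1)], completing the residues of
    [cheb (a + 1), ..., cheb (a + k)]. *)
Lemma hankel_residuek k n1 (n := (k.+1 * n1 + k)%N) : (0 < k)%N ->
  x * y * ((cheb k.+1).[0] * \det (\matrix_(i < n, j < n) mu (i + j + 1) k)) =
  (-1) ^+ (n * k.+1) * (x * y) ^+ 'C(n, 2)
  * (- ((1 + x) * (1 + y) * (cheb (k.+1 * n1.+1)).[0])
     * ((-1) ^+ k.+1 * (- (x * y)) ^+ (n1.+1 * 'C(k.+1, 2)))).
Proof.
move=> k_gt0; pose a := (k.+1 * n1.+1)%N.
have aE : a = n.+1 by rewrite /a /n; lia.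
pose b i := if (i == 0)%N then orth n else if (i == 1)%N then mirror a 1
            else cheb (n + i).+1 - cheb a.
rewrite (hankel_christoffel R x y n k b).
- rewrite mulrCA; congr (_ * _).
  have lt1k : (1 < k.+1)%N by [].
  rewrite (det_cheb_coord_expand k b (Ordinal lt1k)) /=; last first.
    by rewrite /b /= cheb_mod_mirror // -/a aE.
  rewrite {1}/b /= [in LHS]aE horner0_mirror1 -aE mulrCA; congr (_ * _).
  rewrite add1n mulrCA; congr (_ * _); rewrite -(det_cheb_mod R x y).
  pose s : 'rV[R]_k := \row_i (if (i == 0 :> nat)%N then x * y else 1).
  have -> : x * y = \det (diag_mx s).
    rewrite det_diag (bigD1 (Ordinal k_gt0)) //= mxE /= big1 ?mulr1 // => i.
    by rewrite mxE -val_eqE /= => /negPf->.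
  rewrite -det_mulmx mul_diag_mx; congr (\det _).
  apply/matrixP => i j; rewrite !mxE /b /bump.
  case: (posnP i) => [i0|i_gt0].
    rewrite i0 /= /orth -aE cheb_modB cheb_mod_mult sub0r -coefZ.
    by rewrite cheb_mod_reflect // expr1 -/a aE subn1 scalerN.
  rewrite add1n /= eqSS (gtn_eqF i_gt0) mul1r.
  by rewrite cheb_modB cheb_mod_mult subr0 -/a aE addSn addnS.
- move=> i le_ik; rewrite /b; case: eqP => [->|/eqP i_gt0].
    by rewrite addn0; exact: orth_monic_size.
  case: eqP => [->|/eqP i_ne1].
    have -> : (n + 1 = a + 0)%N by rewrite aE addn1 addn0.
    exact: monic_size_mirror.
  by apply: monic_size_cheb_diff; rewrite aE; lia.
move=> i j le_ik lt_jn; rewrite /b; case: eqP => _.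
  by rewrite moment_fun_cheb_diff //; lia.
case: eqP => _; first by rewrite moment_fun_mirror // aE; lia.
by rewrite moment_fun_cheb_diff ?aE //; lia.
Qed.

(** Both [mirror a 1] and [mirror a 2] are available: [1 < r] keeps their degrees at most [n + k],
    and [r < k] gives [n <= a - 2], hence orthogonality. Two rows are then supported in the last
    column. *)
Lemma hankel_residue_other k n1 r (n := (k.+1 * n1 + r)%N) : (1 < r < k)%N ->
  (cheb k.+1).[0] * \det (\matrix_(i < n, j < n) mu (i + j + 1) k) = 0.
Proof.
move=> /andP[r_gt1 lt_rk]; pose a := (k.+1 * n1.+1)%N.
have aE : a = (n + (k.+1 - r))%N by rewrite /a /n; lia.
pose b i := if i == (k.+1 - r)%N then mirror a 1
            else if i == (k.+2 - r)%N then mirror a 2 else orth (n + i).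
have mod1 : cheb_mod k (mirror a 1) = 0 by rewrite cheb_mod_mirror // -/a aE; lia.
have mod2 : cheb_mod k (mirror a 2) = 0 by rewrite cheb_mod_mirror // -/a aE; lia.
have neE : (k.+2 - r == k.+1 - r)%N = false by lia.
rewrite (hankel_christoffel R x y n k b).
- have lt1 : (k.+1 - r < k.+1)%N by lia.
  have lt2 : (k.+2 - r < k.+1)%N by lia.
  rewrite (det_two_single_rows _ _ _ (Ordinal lt1) (Ordinal lt2)) ?mulr0 //.
  + by rewrite -val_eqE /= eq_sym neE.
  + move=> j ne_j; rewrite mxE /b /= eqxx /cheb_coord mod1 coef0 ifT //.
    by have := ltn_ord j; move: ne_j; rewrite -val_eqE /=; lia.
  move=> j ne_j; rewrite mxE /b /= neE eqxx /cheb_coord mod2 coef0 ifT //.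
  by have := ltn_ord j; move: ne_j; rewrite -val_eqE /=; lia.
- move=> i le_ik; rewrite /b; case: eqP => [->|_].
    by rewrite -aE -[X in _ = X.+1]addn0; exact: monic_size_mirror.
  case: eqP => [->|_]; last exact: orth_monic_size.
  have -> : (n + (k.+2 - r) = a + 1)%N by rewrite aE; lia.
  exact: monic_size_mirror.
move=> i j le_ik lt_jn; rewrite /b; case: eqP => _.
  by rewrite moment_fun_mirror // aE; lia.
case: eqP => _; first by rewrite moment_fun_mirror // aE; lia.
by rewrite moment_fun_cheb_diff //; lia.
Qed.

End HankelEvaluation.

(** * Signs, exponents and closed forms *)

Lemma Qpoly_mull (R : comNzRingType) (x y : R) k m :
  (y ^+ k.+1 - x ^+ k.+1) * Qpoly x y k m = y ^+ (k.+1 * m) - x ^+ (k.+1 * m).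
Proof.
rewrite !exprM -[RHS]opprB [in RHS]subrXX -mulNr opprB; congr (_ * _).
by apply: eq_bigr => j _; rewrite addn1 !exprM mulrC subn1.
Qed.

Lemma eq_signr (R : nzRingType) a b : odd a = odd b ->
  (-1) ^+ a = (-1) ^+ b :> R.
Proof. by move=> E; rewrite -signr_odd E signr_odd. Qed.

(** By the Binet formula, [Qpoly] is, up to sign, the ratio of the two values at 0; the domain
    hypothesis allows cancelling [y - x]. *)
Lemma cheb_mult_horner0 (R : idomainType) (x y : R) k m : x != y ->
  (cheb R x y (k.+1 * m)).[0]
  = (-1) ^+ (k.+1 * m + k.+1) * ((cheb R x y k.+1).[0] * Qpoly x y k m).
Proof.
move=> ne_xy; have yx0 : y - x != 0 by rewrite subr_eq0 eq_sym.
apply: (mulfI yx0); rewrite mulrCA [(y - x) * (_ * _)]mulrA !horner0_cheb -Qpoly_mull.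
have -> : (-1) ^+ (k.+1 * m).+1
    = (-1) ^+ (k.+1 * m + k.+1) * (-1) ^+ k.+2 :> R.
  rewrite -exprD; apply: eq_signr; rewrite !(oddD, oddM) /= !(oddD, oddM) /=.
  by case: (odd k); case: (odd m).
by ring.
Qed.

(** Clears the division by 2, so that the exponent identities become polynomial ones. *)
Lemma double_bin2 n : ('C(n.+1, 2) * 2 = n.+1 * n)%N.
Proof. by rewrite mulnC mul_bin_left subn1 bin1 mulnC. Qed.

(** Setting the outer variable [xv] to 0 kills its positive powers but keeps those of [yv]. *)
Lemma yv_exp_neq_xv_exp m : (0 < m)%N -> yv ^+ m != xv ^+ m.
Proof.
move=> m_gt0; apply/eqP => /(congr1 (fun p : Zxy => p.[0])).
rewrite !hornerE /= expr0n gtn_eqF // => /eqP.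
by rewrite -size_poly_eq0 size_polyXn.
Qed.

Section ClosedForms.
Variables (R : idomainType) (x y : R) (k : nat).
Hypothesis exp_neq : forall m, (0 < m)%N -> y ^+ m != x ^+ m.
Hypothesis xy_neq0 : x * y != 0.

Local Notation Q := (Qpoly x y k).
Local Notation c := (cheb R x y k.+1).[0].
Local Notation hankel_total n :=
  (\det (\matrix_(i < n, j < n) Pplus_total x y (i + j + 1) k)).

Let ne_xy : x != y.
Proof. by have := @exp_neq 1 isT; rewrite !expr1 eq_sym. Qed.

Lemma cheb_horner0_neq0 : c != 0.
Proof.
have := horner0_cheb R x y k.+1.
apply: contra_eqN => /eqP ->; rewrite mulr0 eq_sym mulf_eq0 signr_eq0 /=.
by rewrite subr_eq0 exp_neq.
Qed.

Lemma hankel_total_residue0 n1 :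
  hankel_total (k.+1 * n1) =
  (-1) ^+ (n1 * 'C(k.+1, 2)) * (x * y) ^+ (k.+1 ^ 2 * 'C(n1.+1, 2) - k.+1 * n1)
  * (Q n1.+1 + (-1) ^+ k * Q n1).
Proof.
apply: (mulfI cheb_horner0_neq0); rewrite hankel_residue0.
rewrite !cheb_mult_horner0 ?ne_xy //.
(* The case [n1 = 0] is split off below so that [k.+1 * n1] can be written as a successor for
   [double_bin2]. *)
have -> : (k.+1 ^ 2 * 'C(n1.+1, 2) - k.+1 * n1
    = 'C(k.+1 * n1, 2) + n1 * 'C(k.+1, 2))%N.
  have := double_bin2 k; have := double_bin2 n1.
  case: n1 => [|m]; first by rewrite !muln0.
  have := double_bin2 (k.+1 * m + k); have -> : ((k.+1 * m + k).+1 = k.+1 * m.+1)%N by lia.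
  by nia.
rewrite (exprNn (x * y)) [(x * y) ^+ (_ + _)]exprD; set s := (-1) ^+ (n1 * _).
have s1 : (-1) ^+ (k.+1 * n1 * k.+1) * (-1) ^+ (k.+1 * n1.+1 + k.+1) = 1 :> R.
  rewrite -exprD -[RHS](expr0 (-1)); apply: eq_signr.
  by rewrite !(oddD, oddM) /=; case: (odd k); case: (odd n1).
(* This sign turns the difference of values at 0 into [Q n1.+1 + (-1)^k Q n1]. *)
have s2 : (-1) ^+ (k.+1 * n1 * k.+1) * (-1) ^+ (k.+1 * n1 + k.+1)
    = - (-1) ^+ k :> R.
  rewrite -exprD -[RHS]mulN1r -exprS; apply: eq_signr.
  by rewrite !(oddD, oddM) /=; case: (odd k); case: (odd n1).
transitivity (s * (x * y) ^+ 'C(k.+1 * n1, 2) * (x * y) ^+ (n1 * 'C(k.+1, 2)) * c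
  * ((-1) ^+ (k.+1 * n1 * k.+1) * (-1) ^+ (k.+1 * n1.+1 + k.+1) * Q n1.+1
  - (-1) ^+ (k.+1 * n1 * k.+1) * (-1) ^+ (k.+1 * n1 + k.+1) * Q n1)).
  by ring.
by rewrite s1 s2; ring.
Qed.

Lemma hankel_total_residue1 n1 : (0 < k)%N ->
  hankel_total (k.+1 * n1).+1 =
  (-1) ^+ (n1 * 'C(k.+1, 2)) * (x * y) ^+ (k.+1 ^ 2 * 'C(n1.+1, 2))
  * (1 + x) * (1 + y) * Q n1.+1.
Proof.
move=> k_gt0.
apply: (mulfI cheb_horner0_neq0); rewrite hankel_residue1 //.
rewrite !cheb_mult_horner0 ?ne_xy //.
have -> : (k.+1 ^ 2 * 'C(n1.+1, 2)
    = 'C((k.+1 * n1).+1, 2) + n1 * 'C(k.+1, 2))%N.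
  have := double_bin2 k; have := double_bin2 n1; have := double_bin2 (k.+1 * n1).
  by nia.
rewrite (exprNn (x * y)) [(x * y) ^+ (_ + _)]exprD; set s := (-1) ^+ (n1 * _); set n := (k.+1 * n1).+1.
have s1 : (-1) ^+ (n * k.+1) * (-1) ^+ (k.+1 * n1.+1 + k.+1) * (-1) ^+ k = -1 :> R.
  rewrite -!exprD -[RHS](expr1 (-1)); apply: eq_signr.
  by rewrite !(oddD, oddM) /= !(oddD, oddM) /=; case: (odd k); case: (odd n1).
transitivity (- ((-1) ^+ (n * k.+1) * (-1) ^+ (k.+1 * n1.+1 + k.+1) * (-1) ^+ k)
  * (s * (x * y) ^+ 'C(n, 2) * (x * y) ^+ (n1 * 'C(k.+1, 2)) * c
  * (1 + x) * (1 + y) * Q n1.+1)).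
  by ring.
by rewrite s1; ring.
Qed.

Lemma hankel_total_residuek n1 : (0 < k)%N ->
  hankel_total (k.+1 * n1 + k) =
  (-1) ^+ (n1.+1 * 'C(k.+1, 2) + k)
  * (x * y) ^+ (k.+1 ^ 2 * 'C(n1.+1, 2) + (k ^ 2 - 1) * n1.+1)
  * (1 + x) * (1 + y) * Q n1.+1.
Proof.
move=> k_gt0; apply: (mulfI xy_neq0).
apply: (mulfI cheb_horner0_neq0); rewrite mulrCA hankel_residuek //.
rewrite !cheb_mult_horner0 ?ne_xy //; set n := (k.+1 * n1 + k)%N.
set e := (_ + (k ^ 2 - 1) * _)%N.
(* The successor accounts for the extra factor [x y] cancelled at the start. *)
have eE : ('C(n, 2) + n1.+1 * 'C(k.+1, 2) = e.+1)%N.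
  have := double_bin2 k; have := double_bin2 n1.
  have := double_bin2 n.-1; rewrite prednK; last by rewrite /n; lia.
  rewrite /e /n; nia.
have s1 : (-1) ^+ (n * k.+1) * (-1) ^+ (k.+1 * n1.+1 + k.+1) * (-1) ^+ k.+1
    = - (-1) ^+ k :> R.
  rewrite -[RHS]mulN1r -!exprD -exprS; apply: eq_signr.
  by rewrite /n !(oddD, oddM) /=; case: (odd k); case: (odd n1).
rewrite (exprNn (x * y)); set s := (-1) ^+ (n1.+1 * _).
transitivity (- ((-1) ^+ (n * k.+1) * (-1) ^+ (k.+1 * n1.+1 + k.+1) * (-1) ^+ k.+1)
  * (s * ((x * y) ^+ 'C(n, 2) * (x * y) ^+ (n1.+1 * 'C(k.+1, 2))) * c
  * (1 + x) * (1 + y) * Q n1.+1)).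
  by ring.
by rewrite s1 -exprD eE exprS exprD -/s; ring.
Qed.

Lemma hankel_total_residue_other n1 r : (1 < r < k)%N ->
  hankel_total (k.+1 * n1 + r) = 0.
Proof.
move=> r_in; apply: (mulfI cheb_horner0_neq0).
by rewrite mulr0 hankel_residue_other.
Qed.

End ClosedForms.

(** * Specialization to integer polynomials in two variables *)

Lemma xvyv_neq0 : xv * yv != 0.
Proof. by rewrite mulf_neq0 ?polyX_eq0 // polyC_eq0 polyX_eq0. Qed.

Theorem theorem4 (n k : nat) : (0 < n)%N ->
  [/\ (forall n1 : nat, n = ((k + 1) * n1)%N ->
         hankel_det n k =
           (-1) ^+ (n1 * 'C(k + 1, 2)) * (xv * yv) ^+ ((k + 1) ^ 2 * 'C(n1 + 1, 2) - n)
           * (Qpoly xv yv k (n1 + 1) + (-1) ^+ k * Qpoly xv yv k n1)),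
      (1 <= k)%N -> forall n1 : nat, n = ((k + 1) * n1 + 1)%N ->
         hankel_det n k =
           (-1) ^+ (n1 * 'C(k + 1, 2)) * (xv * yv) ^+ ((k + 1) ^ 2 * 'C(n1 + 1, 2))
           * (1 + xv) * (1 + yv) * Qpoly xv yv k (n1 + 1),
      (2 <= k)%N -> forall n1 : nat, n = ((k + 1) * n1 + k)%N ->
         hankel_det n k =
           (-1) ^+ ((n1 + 1) * 'C(k + 1, 2) + k)
           * (xv * yv) ^+ ((k + 1) ^ 2 * 'C(n1 + 1, 2) + (k ^ 2 - 1) * (n1 + 1))
           * (1 + xv) * (1 + yv) * Qpoly xv yv k (n1 + 1)
    & [&& n %% (k + 1) != 0, n %% (k + 1) != 1 & n %% (k + 1) != k]%N ->
         hankel_det n k = 0].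
Proof.
have exp_neq := yv_exp_neq_xv_exp; have xy_neq0 := xvyv_neq0.
move=> _; rewrite addn1; split.
- by move=> n1 ->; rewrite addn1; exact: hankel_total_residue0.
- by move=> k_gt0 n1 ->; rewrite !addn1; exact: hankel_total_residue1.
- by move=> /ltnW k_gt0 n1 ->; rewrite addn1; exact: hankel_total_residuek.
move=> /and3P[ne0 ne1 nek].
(* A remainder modulo [k.+1] other than 0, 1 and [k] lies strictly between 1 and [k]. *)
rewrite (divn_eq n k.+1) mulnC; apply: hankel_total_residue_other => //.
by have := ltn_pmod n (ltn0Sn k); move: ne0 ne1 nek; lia.
Qed.
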